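(* There is a proper holomorphic self-map $\mathbf B:\mathbb D^d\to\mathbb D^d$, not biholomorphic, with $\mathrm{Deck}(\mathbf B)=\{\mathrm{identity}\}$.
   Context: $\mathbb D$ is the open unit disc in $\mathbb C$ and $d\ge1$. A holomorphic map $f:\Omega_1\to\Omega_2$ between bounded domains in $\mathbb C^d$ is proper if preimages of compact sets are compact. Let $V_f=\{z\in\Omega_1:J_f(z)=0\}$ be its branch locus, $J_f$ being the complex Jacobian determinant. Then $f$ restricts to an unbranched analytic covering $\Omega_1\setminus f^{-1}f(V_f)\to\Omega_2\setminus f(V_f)$, and $\mathrm{Deck}(f)$ is the group of deck transformations of this covering, i.e. the group of biholomorphisms $h$ of $\Omega_1\setminus f^{-1}f(V_f)$ onto itself with $f\circ h=f$. *)

(* Defs.v *)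
From HB Require Import structures.
From mathcomp Require Import all_boot all_order all_algebra.
From mathcomp Require Import all_classical all_reals all_analysis.
From mathcomp Require Export complex.

Set Implicit Arguments.
Unset Strict Implicit.
Unset Printing Implicit Defensive.

Import Order.TTheory GRing.Theory Num.Theory.
Import numFieldNormedType.Exports.

Local Open Scope classical_set_scope.
Local Open Scope ring_scope.
Local Open Scope complex_scope.

(* The topology and norm of the complex field [R[i]], which, as for every
   numFieldType, the library only puts on the regular module [R[i]^o]. *)
HB.instance Definition _ (R : rcfType) := NormedModule.copy R[i] R[i]^o.

Section SeveralComplexVariables.
Context {R : realType} {d : nat}.
Implicit Types (U V K : set 'rV[R[i]]_d) (f g h : 'rV[R[i]]_d -> 'rV[R[i]]_d).

Definition polydisc : set 'rV[R[i]]_d := [set z | forall j, `|z 0 j| < 1].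

(* Maps are total functions, only their values on the stated domain matter.
   [differentiable] is Frechet differentiability with an [R[i]]-linear
   differential. The notion is the usual one when [U] is open. *)
Definition holomorphic_on U f := forall z, U z -> differentiable f z.

Definition biholomorphic U V f :=
  [/\ holomorphic_on U f, set_fun U V f &
      exists g, [/\ holomorphic_on V g, set_fun V U g,
        {in U, cancel f g} & {in V, cancel g f}]].

Definition proper_on U V f :=
  forall K, K `<=` V -> compact K -> compact (U `&` f @^-1` K).

Definition proper_holomorphic U V f :=
  [/\ holomorphic_on U f, set_fun U V f & proper_on U V f].

Definition branch_locus U f : set 'rV[R[i]]_d :=
  [set z | U z /\ \det ('J f z) = 0].

Definition unbranched_part U f : set 'rV[R[i]]_d :=
  U `\` f @^-1` (f @` branch_locus U f).

(* A deck transformation is a self-map of [unbranched_part U f]. It is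
   represented by its extension by the identity to the whole space, so that
   equality in [Deck U f] is equality of maps on [unbranched_part U f]. *)
Definition Deck U f : set ('rV[R[i]]_d -> 'rV[R[i]]_d) :=
  [set h | let W := unbranched_part U f in
    [/\ biholomorphic W W h,
        forall z, W z -> f (h z) = f z &
        forall z, ~ W z -> h z = z]].

End SeveralComplexVariables.

Arguments polydisc : clear implicits.

(* Main.v *)
From HB Require Import structures.
Require Import Defs.
From mathcomp Require Import all_boot all_order all_algebra.
From mathcomp Require Import all_classical all_reals all_analysis.
From mathcomp Require Import ring lra.

(** Take B(z_0, ..., z_n) = (b(z_0), z_1, ..., z_n), where
    b(z) = z^2 (2z - 1) / (2 - z) is a finite Blaschke product of degree 3.
    It is continuous on the closed disc and maps the disc into itself and the
    circle into itself, which makes B a proper self-map of the polydisc; B is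
    not injective because b(0) = b(1/2) = 0.

    A deck transformation of B preserves the coordinates z_1, ..., z_n, and on
    each slice where these are constant its first coordinate is a continuous
    function g on the disc minus finitely many points, with b(g(z)) = b(z).
    Continuity of g is enough to conclude ([section_rigid]).  The difference
    factors as b(z) - b(w) = (z - w) q(z, w) / ((2 - z) (2 - w)) with q
    quadratic in w.  Off the fibres of the critical values exactly one of
    g(z) = z and q(z, g(z)) = 0 holds, and by the intermediate value theorem
    the same one holds all along a path ([vanishing_propagates]).  As only
    finitely many points are excluded, any two of the others are joined by a
    path in the domain ([avoiding_path]), so the alternative is global.

    The second case is ruled out by monodromy.  It would make
    4 (2 - z) g(z) + (2z - 1) (2 - z) a continuous square root of the
    discriminant of q(z, .), which has a simple zero at z = 1/2: the fibre of
    b over 0 is {0, 0, 1/2}, and turning around 1/2 exchanges the two preimages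
    close to 0.  Along the loop z = 1/2 + e v^2, where v runs from -1 to 1
    in the upper half plane, such a square root divided by v and by a suitable
    constant has a square of positive real part, so its own real part does not
    vanish; yet that real part changes sign between the end points
    ([no_discriminant_root]).  Hence g is the identity. *)

Set Implicit Arguments.
Unset Strict Implicit.
Unset Printing Implicit Defensive.

Import Order.TTheory GRing.Theory Num.Theory.
Import numFieldNormedType.Exports.

Local Open Scope classical_set_scope.
Local Open Scope ring_scope.
Local Open Scope complex_scope.

Local Notation Re := complex.Re.
Local Notation Im := complex.Im.

(** * The Blaschke product and the equation of its fibres *)

Section Fibers.
Context {K : numFieldType}.
Implicit Types z w : K.

Definition blaschke z : K := z ^+ 2 * (2 * z - 1) / (2 - z).

(** Apart from [z] itself, the points [w] of the fibre of [blaschke] through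
    [z] are the roots of this quadratic polynomial in [w], by [blaschkeB].  On
    the diagonal it is, up to a unit, the derivative of [blaschke]. *)
Definition fiber_quadratic z w : K :=
  2 * (2 - z) * w ^+ 2 + (2 * z - 1) * (2 - z) * w + 2 * z * (2 * z - 1).

(** The discriminant of [fiber_quadratic z], divided by [2 * z - 1]. *)
Definition discr_cofactor z : K :=
  (2 - z) * ((2 * z - 1) * (2 - z) - 16 * z).

Lemma le1_neq2 z : `|z| <= 1 -> 2 - z != 0.
Proof.
apply: contraTneq => /eqP; rewrite subr_eq0 => /eqP <-.
by rewrite normr_nat lern1.
Qed.

Lemma lt1_neq2 z : `|z| < 1 -> 2 - z != 0.
Proof. by move=> /ltW /le1_neq2. Qed.

Lemma blaschkeB z w : 2 - z != 0 -> 2 - w != 0 ->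
  blaschke z - blaschke w = (z - w) * fiber_quadratic z w / ((2 - z) * (2 - w)).
Proof. by move=> z2 w2; rewrite /blaschke /fiber_quadratic; field; rewrite z2 w2. Qed.

Lemma blaschke_fiber z w : 2 - z != 0 -> 2 - w != 0 ->
  blaschke w = blaschke z -> (z - w) * fiber_quadratic z w = 0.
Proof.
move=> z2 w2 wz; have /eqP := blaschkeB z2 w2; rewrite wz subrr eq_sym.
rewrite mulf_eq0 => /orP[/eqP //|].
by rewrite invr_eq0 mulf_eq0 (negPf z2) (negPf w2).
Qed.

(** Completing the square: the derivative in [w] of a quadratic polynomial
    squares to the discriminant at each root. *)
Lemma fiber_discriminant z w : fiber_quadratic z w = 0 ->
  (4 * (2 - z) * w + (2 * z - 1) * (2 - z)) ^+ 2 = (2 * z - 1) * discr_cofactor z.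
Proof.
move=> q0; rewrite -[RHS]addr0 -(mulr0 (8 * (2 - z))) -q0.
by rewrite /fiber_quadratic /discr_cofactor; ring.
Qed.

Lemma discr_cofactor_half : discr_cofactor 2^-1 = -12.
Proof. by rewrite /discr_cofactor; field. Qed.

Lemma is_derive_blaschke z : 2 - z != 0 ->
  is_derive z 1 blaschke (fiber_quadratic z z / (2 - z) ^+ 2).
Proof.
move=> z2.
have d2 : is_derive z (1 : K) (fun x : K => 2 - x) (- 1).
  rewrite (_ : (fun _ => _) = (cst (2 : K) - id)) //.
  by apply: is_derive_eq; rewrite sub0r.
have dV : is_derive z (1 : K) (fun x : K => (2 - x)^-1) ((2 - z) ^- 2).
  apply: DeriveDef; first exact: derivableV.
  rewrite deriveV//.
  by rewrite derive_val scalerN scaleNr opprK scaler1.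
have dN : is_derive z (1 : K) (fun x => x ^+ 2 * (2 * x - 1))
    (6 * z ^+ 2 - 2 * z).
  rewrite (_ : (fun _ => _) = (id ^+ 2 * (2 *: id - cst (1 : K)))) //.
  apply: is_derive_eq.
  change (z ^+ 2 * (2 * 1 - 0) + (2 * z - 1) * (2 * z ^+ 1 * 1) = 6 * z ^+ 2 - 2 * z).
  ring.
rewrite (_ : blaschke =
    (fun x => x ^+ 2 * (2 * x - 1)) * (fun x => (2 - x)^-1)) //.
apply: is_derive_eq.
change (z ^+ 2 * (2 * z - 1) * (2 - z) ^- 2 + (2 - z)^-1 * (6 * z ^+ 2 - 2 * z) =
  fiber_quadratic z z / (2 - z) ^+ 2).
by rewrite /fiber_quadratic; field.
Qed.

Lemma fiber_quadratic_continuous (g : K -> K) z : {for z, continuous g} ->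
  {for z, continuous (fun x : K => fiber_quadratic x (g x))}.
Proof.
move=> cg; have cid : {for z, continuous (fun x : K => x)} by exact: cvg_id.
have cc (a : K) : {for z, continuous (fun _ : K => a)} by exact: cst_continuous.
have c2 : {for z, continuous (fun x : K => 2 - x)} by exact: (continuousB (cc _) cid).
have c2z : {for z, continuous (fun x : K => 2 * x)} by exact: (continuousM (cc _) cid).
have c1 : {for z, continuous (fun x : K => 2 * x - 1)}.
  by exact: (continuousB c2z (cc _)).
have c22 : {for z, continuous (fun x : K => 2 * (2 - x))}.
  by exact: (continuousM (cc _) c2).
exact: (continuousD (continuousD (continuousM c22 (continuousM cg cg))
   (continuousM (continuousM c1 c2) cg)) (continuousM c2z c1)).
Qed.

Lemma discr_root_continuous (g : K -> K) z : {for z, continuous g} ->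
  {for z, continuous (fun x : K => 4 * (2 - x) * g x + (2 * x - 1) * (2 - x))}.
Proof.
move=> cg; have cid : {for z, continuous (fun x : K => x)} by exact: cvg_id.
have cc (a : K) : {for z, continuous (fun _ : K => a)} by exact: cst_continuous.
have c2 : {for z, continuous (fun x : K => 2 - x)} by exact: (continuousB (cc _) cid).
have c1 : {for z, continuous (fun x : K => 2 * x - 1)}.
  by exact: (continuousB (continuousM (cc _) cid) (cc _)).
exact: (continuousD (continuousM (continuousM (cc _) c2) cg) (continuousM c1 c2)).
Qed.

Lemma discr_cofactor_continuous : continuous (discr_cofactor : K -> K).
Proof.
move=> z; have cid : {for z, continuous (fun x : K => x)} by exact: cvg_id.
have cc (a : K) : {for z, continuous (fun _ : K => a)} by exact: cst_continuous.
have c2 : {for z, continuous (fun x : K => 2 - x)} by exact: (continuousB (cc _) cid).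
have c1 : {for z, continuous (fun x : K => 2 * x - 1)}.
  by exact: (continuousB (continuousM (cc _) cid) (cc _)).
exact: (continuousM c2 (continuousB (continuousM c1 c2) (continuousM (cc _) cid))).
Qed.

End Fibers.

(** * The topology of the complex plane *)

Lemma near_dist_lt {K : numFieldType} (f : K -> K) (z e : K) :
  {for z, continuous f} -> 0 < e -> nbhs z [set w | `|f w - f z| < e].
Proof. by move=> cf e0; apply: (@cvgr_distC_lt _ _ _ _ (nbhs_filter z) f (f z)). Qed.

Lemma subr_continuous {K : numFieldType} (g : K -> K) (z : K) :
  {for z, continuous g} -> {for z, continuous (fun x : K => x - g x)}.
Proof.
move=> cg; have cid : {for z, continuous (fun x : K => x)} by exact: cvg_id.
exact: continuousB cid cg.
Qed.

Section Topology.
Context {R : realType}.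
Implicit Types z w : R[i].

Lemma gt0_ReIm z : 0 < z -> Im z = 0 /\ 0 < Re z.
Proof. by case: z => a b; rewrite ltcE /= => /andP[/eqP ->]. Qed.

Lemma normc_ge_Im z : `|Im z|%:C <= `|z|.
Proof.
have := normc_ge_Re (z * 'i%C); rewrite ReiNIm normrN normrM.
by rewrite (normc_def 'i%C) /= expr0n add0r expr1n sqrtr1 mulr1.
Qed.

Lemma real_complex_continuous : continuous (real_complex R : R -> R[i]).
Proof.
move=> x; apply/cvgrPdist_lt => e e0.
have [ie re] := gt0_ReIm e0.
near=> y; rewrite -rmorphB.
rewrite ltcE /= ie/= expr0n/= addr0 sqrtr_sqr eqxx/=.
near: y; exact: cvgr_dist_lt.
Unshelve. all: by end_near. Qed.

Lemma Re_continuous : continuous (fun z : R[i] => Re z).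
Proof.
move=> z; apply/(@cvgrPdist_lt _ R _ _ (nbhs_filter z)) => e e0.
have ce0 : (0 : R[i]) < e%:C by rewrite ltcR.
have zb : nbhs z (ball z e%:C) := nbhsx_ballx z _ ce0.
apply: (@filterS _ (nbhs z) _ _ _ _ zb) => y zy.
rewrite -ltcR -raddfB; exact: le_lt_trans (normc_ge_Re _) zy.
Qed.

Lemma norm_Re_norm z : `|z| = (Re `|z|)%:C.
Proof. by rewrite normc_def. Qed.

Lemma Re_norm_continuous : continuous (fun z : R[i] => Re `|z|).
Proof.
move=> z; apply: (@continuous_comp R[i] R[i] R (fun z => `|z|)).
  exact: norm_continuous.
exact: Re_continuous.
Qed.

(** The disc is closed in the image of a compact square of the real plane. *)
Lemma closed_disc_compact : compact [set z : R[i] | `|z| <= 1].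
Proof.
pose sq : set (R * R) := `[-1, 1] `*` `[-1, 1].
pose f (p : R * R) : R[i] := p.1%:C + 'i%C * p.2%:C.
have cf : continuous f.
  move=> p; apply: cvgD.
    by apply: continuous_comp; [exact: cvg_fst|exact: real_complex_continuous].
  apply: cvgM; first exact: cvg_cst.
  by apply: continuous_comp; [exact: cvg_snd|exact: real_complex_continuous].
apply: (@subclosed_compact _ _ (f @` sq)).
- rewrite (_ : [set z | _] = (fun z => Re `|z|) @^-1` [set x | x <= 1]).
    by apply: closed_comp => // z _; exact: Re_norm_continuous.
  by apply/seteqP; split => z /=; rewrite [ `|z| ]norm_Re_norm lecR.
- apply: continuous_compact; first exact/continuous_subspaceT.
  by apply: compact_setX; exact: segment_compact.
- move=> z /= z1; exists (Re z, Im z); last by rewrite /f /= -complexE.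
  by split; rewrite /= in_itv /= -ler_norml -lecR; apply: le_trans z1;
    [exact: normc_ge_Re|exact: normc_ge_Im].
Qed.

Lemma continuous_keeps_sign (f : R -> R) (a b : R) : a <= b ->
  (forall t, a <= t <= b -> {for t, continuous f}) ->
  (forall t, a <= t <= b -> f t != 0) -> f a < 0 -> f b < 0.
Proof.
move=> ab cf f0 fa; rewrite ltNge; apply/negP => fb.
have [|| t tab /eqP ft] := @IVT R f a b 0 ab.
- apply: continuous_in_subspaceT => t; rewrite inE/= in_itv/=; exact: cf.
- by rewrite ge_min le_max (ltW fa) fb orbT.
by move: tab; rewrite in_itv/= => /f0; rewrite ft.
Qed.

End Topology.

(** * Paths in the punctured disc *)

Section Paths.
Context {R : realType}.
Implicit Types z w : R[i].

(** The real function [|u| - |v|] has no zero, because one of [u] and [v]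
    vanishes and the other does not; its sign tells which one. *)
Lemma vanishing_propagates (u v : R -> R[i]) (a b : R) : a <= b ->
  (forall t, a <= t <= b -> {for t, continuous u}) ->
  (forall t, a <= t <= b -> {for t, continuous v}) ->
  (forall t, a <= t <= b -> u t * v t = 0) ->
  (forall t, a <= t <= b -> u t = 0 -> v t != 0) ->
  u a = 0 -> u b = 0.
Proof.
move=> ab cu cv uv0 uv ua.
have norm0 z : z != 0 -> 0 < Re `|z| by rewrite -normr_gt0 => /gt0_ReIm[].
have : Re `|u b| - Re `|v b| < 0.
  apply: (continuous_keeps_sign (f := fun t => Re `|u t| - Re `|v t|) ab).
  - move=> t tab; apply: cvgB.
      by apply: continuous_comp; [exact: cu|exact: Re_norm_continuous].
    by apply: continuous_comp; [exact: cv|exact: Re_norm_continuous].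
  - move=> t tab; have /eqP := uv0 t tab; rewrite mulf_eq0 => /orP[]/eqP t0.
      have := norm0 _ (uv t tab t0); rewrite t0 normr0; lra.
    have ut : u t != 0 by apply/eqP => /(uv t tab); rewrite t0 eqxx.
    have := norm0 _ ut; rewrite t0 normr0; lra.
  - have aab : a <= a <= b by rewrite lexx.
    have := norm0 _ (uv a aab ua); rewrite ua normr0 /=; lra.
have bab : a <= b <= b by rewrite lexx andbT.
have /eqP := uv0 b bab; rewrite mulf_eq0 => /orP[]/eqP //.
move=> v0; have [//|/norm0 ub] := eqVneq (u b) 0.
by rewrite v0 normr0 subr0 => /(lt_trans ub); rewrite ltxx.
Qed.

Lemma fresh_real (s : seq R) (e : R) : 0 < e -> exists2 x, 0 < x < e & x \notin s.
Proof.
suff: forall e, 0 < e -> exists2 d, 0 < d <= e & forall x, 0 < x < d -> x \notin s.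
  move=> + e0 => /(_ e e0)[d /andP[d0 de] ds]; exists (d / 2); last by apply: ds; lra.
  by lra.
elim: s => [|y s IH] {}e e0; first by exists e; rewrite ?e0 /=.
have [y0|y0] := ltrP 0 y.
  have [|d /andP[d0 de] ds] := IH (Num.min y e); first by rewrite lt_min y0.
  move: de; rewrite le_min => /andP[dy de].
  exists d => [|x /andP[x0 xd]]; first by rewrite d0.
  by rewrite inE negb_or ds ?x0// andbT lt_eqF// (lt_le_trans xd).
have [d /andP[d0 de] ds] := IH e e0.
exists d => [|x /andP[x0 xd]]; first by rewrite d0.
by rewrite inE negb_or ds ?x0// andbT gt_eqF// (le_lt_trans y0).
Qed.

Lemma poly_roots_seq (p : {poly R[i]}) : p != 0 ->
  exists s : seq R[i], forall z, root p z -> z \in s.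
Proof.
move=> p0; have [s ps] := closed_field_poly_normal p; exists s => z.
by rewrite ps rootZ ?lead_coef_eq0// root_prod_XsubC.
Qed.

(** The arcs [t + i x t (1 - t)], suitably rescaled, join the end points, and
    for distinct [x] they meet only there.  So each point of [s] excludes at
    most one [x]; for small [x] the arc is so close to the segment that it
    stays in the disc, which is convex. *)
Lemma avoiding_path (s : seq R[i]) z p : `|z| < 1 -> `|p| < 1 ->
  exists gam : R -> R[i], [/\ continuous gam, gam 0 = z, gam 1 = p &
    forall t, 0 <= t <= 1 -> `|gam t| < 1 /\ (gam t \in s -> gam t = z \/ gam t = p)].
Proof.
move=> z1 p1; have [<-{p p1}|zp] := eqVneq z p.
  exists (cst z); split => // [t|t _]; first exact: cvg_cst.
  by split=> //; left.
(* The only parameter [x] whose arc may contain [f]. *)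
pose c f : R := let q := (f - z) / (p - z) in Im q / (Re q * (1 - Re q)).
pose m := Num.max (Re `|z|) (Re `|p|).
have m1 : m < 1 by rewrite gt_max -!ltcR -!norm_Re_norm z1 p1.
have [|x /andP[x0 xm] xs] := fresh_real [seq c f | f <- s] (_ : 0 < (1 - m) / 2).
  by lra.
pose gam (t : R) := z + (t%:C + 'i%C * (x * (t * (1 - t)))%:C) * (p - z).
exists gam; split.
- move=> t; apply: cvgD; first exact: cvg_cst.
  apply: cvgM; last exact: cvg_cst.
  apply: cvgD; first exact: real_complex_continuous.
  apply: cvgM; first exact: cvg_cst.
  apply: (@continuous_comp _ _ _ (fun t : R => x * (t * (1 - t))));
    last exact: real_complex_continuous.
  apply: cvgM; first exact: cvg_cst.
  by apply: cvgM; [exact: cvg_id|apply: cvgB; [exact: cvg_cst|exact: cvg_id]].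
- by rewrite /gam mul0r mulr0 rmorph0 mulr0 addr0 mul0r addr0.
- by rewrite /gam subrr !mulr0 rmorph1 addr0 mul1r addrC subrK.
move=> t /andP[t0 t1]; split.
  have -> : gam t = (1 - t)%:C * z + t%:C * p + 'i%C * (x * (t * (1 - t)))%:C * (p - z).
    by rewrite /gam rmorphB rmorph1; ring.
  have zm : `|z| <= m%:C by rewrite norm_Re_norm lecR le_max lexx.
  have pm : `|p| <= m%:C by rewrite norm_Re_norm lecR le_max lexx orbT.
  have pz2 : `|p - z| <= (2 : R)%:C.
    by rewrite (le_trans (ler_normB _ _))// rmorph_nat (natrD _ 1 1) lerD ?ltW.
  have normR (r : R) : 0 <= r -> `|r%:C| = r%:C by move=> r0; rewrite ger0_norm// ler0c.
  have normi : `|'i%C| = 1 :> R[i].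
    by rewrite normc_def /= expr0n add0r expr1n sqrtr1.
  have tt0 : 0 <= t * (1 - t) by rewrite mulr_ge0// subr_ge0.
  apply: (@le_lt_trans _ _ ((1 - t) * m + t * m + x * (t * (1 - t)) * 2)%:C).
    rewrite (le_trans (ler_normD _ _))// [X in _ <= X]rmorphD lerD//.
      rewrite (le_trans (ler_normD _ _))// [X in _ <= X]rmorphD lerD//.
        by rewrite normrM normR ?subr_ge0// rmorphM ler_wpM2l// ler0c subr_ge0.
      by rewrite normrM normR// rmorphM ler_wpM2l// ler0c.
    rewrite normrM (normrM 'i%C) normi mul1r normR; last by rewrite mulr_ge0// ltW.
    rewrite [X in _ <= X]rmorphM ler_wpM2l//.
    by rewrite ler0c mulr_ge0 ?(ltW x0).
  rewrite ltcR; have : t * (1 - t) <= 1 by rewrite mulr_ile1 ?subr_ge0//; lra.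
  by nra.
move=> gs.
have [gz|gz] := eqVneq (gam t) z; [by left|right].
have [//|gp] := eqVneq (gam t) p.
have pz : p - z != 0 by rewrite subr_eq0 eq_sym.
move/negP: xs; case; apply/mapP; exists (gam t) => //.
rewrite /c (_ : (gam t - z) / (p - z) = t +i* (x * (t * (1 - t)))); last first.
  by rewrite /gam addrC addKr mulfK// [RHS]complexE.
rewrite /= mulfK// mulf_eq0 subr_eq0 (eq_sym 1); apply/negP => /orP[]/eqP t01.
  by case/eqP: gz; rewrite /gam t01 mul0r mulr0 rmorph0 mulr0 addr0 mul0r addr0.
by case/eqP: gp; rewrite /gam t01 subrr !mulr0 rmorph1 addr0 mul1r addrC subrK.
Qed.

End Paths.

(** * Monodromy around the point 1/2 *)

Section Rigidity.
Context {R : realType}.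
Implicit Types z w : R[i].

Lemma near_notin (s : seq R[i]) z : nbhs z [set w | w != z -> w \notin s].
Proof.
elim: s => [|y s IH]; first by apply: (@filterE _ (nbhs z)) => w.
have [->|zy] := eqVneq y z.
  by apply: (@filterS _ (nbhs z) _ _ _ _ IH) => w h wz; rewrite /= inE negb_or wz h.
have e0 : 0 < `|z - y| by rewrite normr_gt0 subr_eq0 eq_sym.
apply: (@filterS2 _ (nbhs z) _ _ _ _ _ IH (nbhsx_ballx z _ e0)) => w h wy wz.
rewrite /= inE negb_or h// andbT; apply: contraPneq wy => ->.
by rewrite /ball/= ltxx.
Qed.

(** The value of [discr_cofactor] at 1/2 is -12, so the last condition keeps it
    in the half plane of negative real parts. *)
Lemma good_radius (s : seq R[i]) : exists2 rho : R, 0 < rho &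
  forall z, `|z - 2^-1| < rho%:C ->
    [/\ `|z| < 1, z != 2^-1 -> z \notin s & `|discr_cofactor z + 12| < 12].
Proof.
have h0 : 0 < 2^-1 :> R[i] by rewrite invr_gt0 ltr0n.
have E0 : discr_cofactor (2^-1 : R[i]) = -12 by exact: discr_cofactor_half.
have [e e0 eP] : exists2 e : R[i], 0 < e & ball (2^-1 : R[i]) e `<=`
    [set z | `|z| < 1] `&` [set z | z != 2^-1 -> z \notin s] `&`
    [set z | `|discr_cofactor z + 12| < 12].
  apply/nbhs_ballP; apply: filterI; first apply: filterI.
  - apply: filterS (nbhsx_ballx (2^-1 : R[i]) _ h0) => z; rewrite /ball /= distrC => zh.
    rewrite -[z](subrK 2^-1) (le_lt_trans (ler_normD _ _))//.
    rewrite (ger0_norm (ltW h0)) -ltrBrDr (lt_le_trans zh)//.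
    by rewrite [X in _ <= X - _]splitr mul1r addrK.
  - exact: near_notin.
  - have e12 : 0 < 12 :> R[i] by rewrite ltr0n.
    have := near_dist_lt (@discr_cofactor_continuous R[i] 2^-1) e12.
    by rewrite E0 opprK.
have [Ie Re0] := gt0_ReIm e0.
exists (Re e) => // z ze; have [|[z1 zs] zE] := eP z; last by [].
 rewrite /ball/= distrC.
by rewrite [e]complexE Ie rmorph0 mulr0 addr0.
Qed.

(** An arc from -1 to 1 avoiding 0, so that its square is a loop around 0. *)
Definition half_loop (t : R) : R[i] := t%:C + 'i%C * (1 - t ^+ 2)%:C.

Lemma half_loopE t : half_loop t = t +i* (1 - t ^+ 2).
Proof. by rewrite [RHS]complexE. Qed.

Lemma half_loop_continuous : continuous half_loop.
Proof.
move=> t; apply: cvgD; first exact: real_complex_continuous.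
apply: cvgM; first exact: cvg_cst.
apply: (@continuous_comp _ _ _ (fun t : R => 1 - t ^+ 2));
  last exact: real_complex_continuous.
by apply: cvgB; [exact: cvg_cst|exact: exprn_continuous].
Qed.

Lemma half_loop_neq0 t : half_loop t != 0.
Proof.
rewrite half_loopE eq_complex /=; apply/negP => /andP[/eqP-> /eqP].
by rewrite expr0n subr0 => /eqP; rewrite oner_eq0.
Qed.

Lemma half_loop_norm t : -1 <= t <= 1 -> `|half_loop t| <= 1.
Proof.
move=> t1; rewrite -(expr_le1 (ltn0Sn 1))// -add_Re2_Im2 half_loopE /= lecR.
have : 0 <= t ^+ 2 * (1 - t ^+ 2) by rewrite mulr_ge0 ?sqr_ge0//; nra.
lra.
Qed.

(** The square of a purely imaginary number is at distance at least 1 from 1. *)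
Lemma Re_neq0 z : `|1 - z ^+ 2| < 1 -> Re z != 0.
Proof.
apply: contraTneq => z0; rewrite (_ : 1 - z ^+ 2 = (1 + Im z ^+ 2)%:C); last first.
  rewrite [z in LHS]complexE z0 rmorph0 add0r exprMn sqr_i mulN1r opprK.
  by rewrite rmorphD rmorph1 rmorphXn.
have h : 1 <= 1 + Im z ^+ 2 by rewrite lerDl sqr_ge0.
rewrite ger0_norm ?ler0c ?(le_trans _ h)// -(rmorph1 (real_complex R)) ltcR.
by rewrite -leNgt.
Qed.

(** The discriminant has odd order at 1/2, so a continuous square root of it
    would change sign after one turn around this point. *)
Lemma no_discriminant_root (rho : R) (e : R[i]) (sg : R[i] -> R[i]) :
  e != 0 -> `|e| < rho%:C ->
  (forall z, `|z - 2^-1| < rho%:C -> `|discr_cofactor z + 12| < 12) ->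
  (forall z, z != 2^-1 -> `|z - 2^-1| < rho%:C -> {for z, continuous sg}) ->
  (forall z, z != 2^-1 -> `|z - 2^-1| < rho%:C ->
    sg z ^+ 2 = (2 * z - 1) * discr_cofactor z) -> False.
Proof.
move=> e0 erho Erho csg sgE.
(* With [v] the half loop, [sg (z t) ^+ 2 = 2 * e * v ^+ 2 * E] where [E] is
   at distance less than 12 from -12; the constant [k] turns the square of
   [sg (z t) / (v * k)] into [- E / 12], at distance less than 1 from 1. *)
have [k kE] : exists k : R[i], k ^+ 2 = - 24 * e.
  by exists (sqrtc (- 24 * e)); exact: sqr_sqrtc.
have k0 : k != 0 by rewrite -sqrf_eq0 kE mulf_neq0// oppr_eq0 pnatr_eq0.
pose z t := 2^-1 + e * half_loop t ^+ 2.
have zrho t : -1 <= t <= 1 -> `|z t - 2^-1| < rho%:C.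
  move=> /half_loop_norm t1; rewrite /z addrC addKr normrM normrX.
  by rewrite (le_lt_trans _ erho)// ler_piMr// exprn_ile1.
have zh t : z t != 2^-1.
  by rewrite -subr_eq0 /z addrC addKr mulf_neq0// sqrf_eq0 half_loop_neq0.
have cz : continuous z.
  move=> t; apply: cvgD; first exact: cvg_cst.
  by apply: cvgM; [exact: cvg_cst|apply: cvgM; exact: half_loop_continuous].
pose r t := sg (z t) / (half_loop t * k).
have r2 t : -1 <= t <= 1 -> r t ^+ 2 = - (discr_cofactor (z t) / 12).
  move=> t1; rewrite /r expr_div_n exprMn kE sgE//; last exact: zrho.
  rewrite {1}/z; set E := discr_cofactor _.
  by have v0 := half_loop_neq0 t; field; rewrite v0 e0.
have cr t : -1 <= t <= 1 -> {for t, continuous (fun t => Re (r t))}.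
  move=> t1; apply: continuous_comp; last exact: Re_continuous.
  apply: cvgM.
    by apply: continuous_comp; [exact: cz|apply: csg => //; exact: zrho].
  apply: cvgV; first by rewrite mulf_neq0// half_loop_neq0.
  by apply: cvgM; [exact: half_loop_continuous|exact: cvg_cst].
have r0 t : -1 <= t <= 1 -> Re (r t) != 0.
  move=> t1; apply: Re_neq0; rewrite r2// opprK.
  rewrite -(ltr_pM2r (_ : 0 < `|12|)) ?normr_gt0 ?pnatr_eq0// -normrM mulrDl mul1r.
  rewrite mulfVK ?pnatr_eq0// normr_nat mul1r addrC.
  exact/Erho/zrho.
(* The point [z t] is the same at both ends, while [half_loop] changes sign. *)
have rN : Re (r 1) = - Re (r (-1)).
  have -> : r 1 = - r (-1).
    rewrite /r /z /half_loop sqrrN expr1n subrr rmorph0 mulr0 !addr0.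
    by rewrite rmorphN rmorph1 sqrrN !mulN1r invrN mulrN opprK mul1r.
  by rewrite raddfN.
have l1 : -1 <= 1 :> R := le_trans (lerN10 _) ler01.
have m1 : (-1 <= -1 :> R) && (-1 <= 1 :> R) by rewrite lexx l1.
have := r0 _ m1; rewrite neq_lt => /orP[h|h].
  have := continuous_keeps_sign l1 cr r0 h.
  by rewrite rN oppr_lt0 => /(lt_trans h); rewrite ltxx.
suff : - Re (r 1) < 0 by rewrite rN opprK => /(lt_trans h); rewrite ltxx.
apply: (continuous_keeps_sign (f := fun t => - Re (r t)) l1); last by rewrite oppr_lt0.
- by move=> t t1; apply: cvgN; exact: cr.
- by move=> t t1; rewrite oppr_eq0 r0.
Qed.

(** If [g] moved one point, it would move every point of a punctured
    neighbourhood of 1/2, by propagation along paths in [W], and would thus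
    provide a continuous square root of the discriminant there. *)
Lemma section_rigid (s : seq R[i]) (W : set R[i]) (g : R[i] -> R[i]) :
  (forall z, W z -> `|z| < 1) ->
  (forall z, `|z| < 1 -> z \notin s -> W z) ->
  (forall z, W z -> {for z, continuous g}) ->
  (forall z, W z -> (z - g z) * fiber_quadratic z (g z) = 0) ->
  (forall z, W z -> fiber_quadratic z z != 0) ->
  forall z, W z -> g z = z.
Proof.
move=> Wd sW cg gq q0 z Wz; apply/eqP/negPn/negP => gz.
have [rho rho0 Prho] := good_radius s.
have Wrho q : q != 2^-1 -> `|q - 2^-1| < rho%:C -> W q.
  by move=> qh /Prho[q1 /(_ qh) qs _]; exact: sW.
have qg q : q != 2^-1 -> `|q - 2^-1| < rho%:C -> fiber_quadratic q (g q) = 0.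
  move=> qh qrho; have Wq := Wrho q qh qrho.
  have [gam [cgam g0 g1 gamP]] := avoiding_path s (Wd _ Wz) (Wd _ Wq).
  have Wgam t : 0 <= t <= 1 -> W (gam t).
    move=> /gamP[gt1 gts]; have [/gts[] -> //|] := boolP (gam t \in s).
    exact: sW.
  rewrite -g1; apply: (@vanishing_propagates _
    (fun t => fiber_quadratic (gam t) (g (gam t)))
    (fun t => gam t - g (gam t)) 0 1); first exact: ler01.
  - move=> t t01.
    apply: (@continuous_comp R R[i] R[i] gam (fun z => fiber_quadratic z (g z))).
      exact: cgam.
    exact/fiber_quadratic_continuous/cg/Wgam.
  - move=> t t01; apply: (@continuous_comp R R[i] R[i] gam (fun z => z - g z)).
      exact: cgam.
    exact/subr_continuous/cg/Wgam.
  - by move=> t t01; rewrite mulrC; exact/gq/Wgam.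
  - move=> t t01 qt; apply/eqP => /eqP; rewrite subr_eq0 => /eqP gt.
    by have := q0 _ (Wgam t t01); rewrite {2}gt qt eqxx.
  - by have /eqP := gq _ Wz; rewrite g0 mulf_eq0 subr_eq0 eq_sym (negPf gz) => /eqP.
pose e : R[i] := (rho / 2)%:C.
apply: (@no_discriminant_root rho e
  (fun z => 4 * (2 - z) * g z + (2 * z - 1) * (2 - z))).
- by rewrite /e gt_eqF// ltcR divr_gt0.
- by rewrite ger0_norm ?ler0c ?ltcR; lra.
- by move=> q /Prho[].
- by move=> q qh qr; exact/discr_root_continuous/cg/Wrho.
- by move=> q qh qr; exact/fiber_discriminant/qg.
Qed.

End Rigidity.

(** * Norms of values of the Blaschke product *)

Section BlaschkeNorm.
Context {R : realType}.
Implicit Types z : R[i].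

(** The Moebius factor [(2 * z - 1) / (2 - z)] preserves the disc and the circle
    because this difference has the sign of [1 - |z|^2]. *)
Lemma normB_mobius z :
  `|2 - z| ^+ 2 - `|2 * z - 1| ^+ 2 = 3 * (1 - `|z| ^+ 2).
Proof.
rewrite !sqr_normc !(rmorphB, rmorphM) rmorph1 rmorph_nat /=; ring.
Qed.

Lemma norm_blaschke z :
  `|blaschke z| = `|z| ^+ 2 * (`|2 * z - 1| / `|2 - z|).
Proof. by rewrite /blaschke 2!normrM normrX normfV mulrA. Qed.

Lemma blaschke_lt1 z : `|z| < 1 -> `|blaschke z| < 1.
Proof.
move=> z1; have z2 := lt1_neq2 z1.
have z21 : `|z| ^+ 2 < 1 by rewrite expr_lt1.
rewrite norm_blaschke mulr_ilt1 ?exprn_ge0 ?divr_ge0//.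
rewrite ltr_pdivrMr ?normr_gt0// mul1r -ltr_sqr ?nnegrE// -subr_gt0.
by rewrite normB_mobius mulr_gt0// subr_gt0.
Qed.

Lemma norm_blaschke1 z : `|z| = 1 -> `|blaschke z| = 1.
Proof.
move=> z1; have z2 : 2 - z != 0 by apply: le1_neq2; rewrite z1.
have /eqP := normB_mobius z; rewrite norm_blaschke z1 !expr1n subrr mulr0.
rewrite subr_eq0 eqrXn2// => /eqP <-.
by rewrite mul1r divff// normr_eq0.
Qed.

End BlaschkeNorm.

(** * Maps changing only the first coordinate *)

Section Shear.
Context {K : numFieldType} {n : nat}.
Implicit Types (phi : K -> K) (z v : 'rV[K]_n.+1).

Definition shear phi z : 'rV[K]_n.+1 := z + phi (z 0 0) *: delta_mx 0 0.

Lemma shearE phi z j :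
  shear phi z 0 j = if j == 0 then z 0 0 + phi (z 0 0) else z 0 j.
Proof.
rewrite !mxE eqxx /=; case: eqVneq => [->|_]; first by rewrite mulr1.
by rewrite mulr0 addr0.
Qed.

Lemma diff_shear phi z c : is_derive (z 0 0) 1 phi c ->
  is_diff z (shear phi) (shear (fun x => c * x)).
Proof.
move=> dphi.
have dc : is_diff z (fun v : 'rV[K]_n.+1 => v 0 0 : K) (fun v => v 0 0).
  pose f : 'rV[K]_n.+1 -> K := fun v => v 0 0.
  have lf : linear f by move=> a u v; rewrite /f !mxE.
  pose lfM := GRing.isLinear.Build _ _ _ _ _ lf.
  pose L : {linear 'rV[K]_n.+1 -> K} := HB.pack f lfM.
  apply: DiffDef; first exact: differentiable_coord.
  exact: (@diff_lin _ _ _ L z (@coord_continuous _ _ _ _ _)).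
have dp : is_diff (z 0 0) phi (fun h : K => c * h).
  have dv : derivable phi (z 0 0) 1 by [].
  apply: DiffDef; first exact/derivable1_diffP.
  rewrite deriv1E// derive1E derive_val; apply/funext => h.
  by rewrite mulrC.
have dcomp := is_diff_comp dc dp.
have dS : is_diff z (fun v : 'rV[K]_n.+1 => phi (v 0 0) *: delta_mx 0 0 : 'rV[K]_n.+1)
    (fun v => (c * v 0 0) *: delta_mx 0 0).
  have dk : differentiable (fun v : 'rV[K]_n.+1 => phi (v 0 0)) z by case: dcomp.
  apply: DiffDef; first exact: differentiableZl.
  etransitivity; first exact: (diffZl _ dk).
  apply/funext => v; congr (_ *: _).
  by case: dcomp => _ dE; rewrite dE.
exact: (is_diffD (is_diff_id z) dS).
Qed.

(** In the standard basis the differential is diagonal. *)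
Lemma det_jacobian_shear phi z c : is_derive (z 0 0) 1 phi c ->
  \det ('J (shear phi) z) = 1 + c.
Proof.
move=> dphi; have dS := diff_shear dphi.
have -> : 'J (shear phi) z = diag_mx (\row_j if j == 0 then 1 + c else 1).
  apply/matrixP => i j; rewrite /jacobian !mxE diff_val shearE !mxE eqxx /=.
  have [->{i}|/negPf ij] := eqVneq i j; rewrite ?mulr1n ?mulr0n.
    by have [_|_] := eqVneq j 0; rewrite ?mulr1.
  have [j0|//] := eqVneq j 0; move: ij; rewrite j0 eq_sym => ->.
  by rewrite mulr0 addr0.
rewrite det_diag (bigD1 0)//= big1 ?mulr1; first by rewrite mxE eqxx.
by move=> j /negPf j0; rewrite mxE j0.
Qed.

Definition set_first z (x : K) : 'rV[K]_n.+1 := \row_j if j == 0 then x else z 0 j.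

Lemma set_first_id z : set_first z (z 0 0) = z.
Proof. by apply/rowP => j; rewrite mxE; case: eqVneq => [->|]. Qed.

Lemma set_firstE z x : set_first z x = z + (x - z 0 0) *: delta_mx 0 0.
Proof.
apply/rowP => j; rewrite !mxE eqxx /=; case: eqVneq => [->|_].
  by rewrite mulr1 addrC subrK.
by rewrite mulr0 addr0.
Qed.

Lemma set_first_continuous z : continuous (set_first z).
Proof.
rewrite (_ : set_first z = fun x : K => z + (x - z 0 0) *: delta_mx 0 0); last first.
  by apply/funext => y; exact: set_firstE.
move=> x; have cc (V : normedModType K) (v : V) : {for x, continuous (fun _ : K => v)}.
  exact: cst_continuous.
have cid : {for x, continuous (fun y : K => y)} by exact: cvg_id.
have cz : {for x, continuous (fun y : K => y - z 0 0)} := continuousB cid (cc _ _).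
exact: (continuousD (cc _ _) (continuousZ cz (cc _ _))).
Qed.

Lemma slice_continuous (h : 'rV[K]_n.+1 -> 'rV[K]_n.+1) z (x : K) :
  {for set_first z x, continuous h} ->
  {for x, continuous (fun y : K => h (set_first z y) 0 0 : K)}.
Proof.
move=> ch; have cs : {for x, continuous (set_first z)} := @set_first_continuous z x.
have c0 : {for h (set_first z x), continuous (fun v : 'rV[K]_n.+1 => v 0 0 : K)}.
  exact: coord_continuous.
exact: (continuous_comp (continuous_comp cs ch) c0).
Qed.

End Shear.

(** * The branched covering of the polydisc *)

Section Covering.
Context {R : realType}.
Implicit Types x c : R[i].

(** The first coordinates of the points of the unbranched part, by
    [unbranched_partE]. *)
Definition unbranched_disc : set R[i] := [set x | `|x| < 1 /\
  forall c, `|c| < 1 -> fiber_quadratic c c = 0 -> blaschke c <> blaschke x].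

Lemma cofinite_unbranched_disc :
  exists s : seq R[i], forall x, `|x| < 1 -> x \notin s -> unbranched_disc x.
Proof.
(* The roots of [P] are the critical points of [blaschke], those of [Q c] the
   points of the fibre through [c]; both polynomials are nonzero since their
   values at 1 and 2 are. *)
pose P : {poly R[i]} := 'X * (13 *: 'X - 4 *: 'X^2 - 4%:P).
pose Q c : {poly R[i]} := 'X^2 * (2 *: 'X - 1) - blaschke c *: (2%:P - 'X).
have PE x : P.[x] = x * (13 * x - 4 * x ^+ 2 - 4).
  by rewrite !(hornerM, hornerD, hornerN, hornerZ, hornerX, hornerXn, hornerC).
have QE c x : (Q c).[x] = x ^+ 2 * (2 * x - 1) - blaschke c * (2 - x).
  by rewrite !(hornerM, hornerD, hornerN, hornerZ, hornerX, hornerXn, hornerC).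
have P0 : P != 0.
  apply/eqP => /(congr1 (horner^~ 1)); rewrite PE horner0.
  rewrite (_ : _ * _ = 5); last by ring.
  by move/eqP; rewrite pnatr_eq0.
have Q0 c : Q c != 0.
  apply/eqP => /(congr1 (horner^~ 2)); rewrite QE horner0 subrr mulr0 subr0.
  rewrite (_ : _ * _ = 12); last by ring.
  by move/eqP; rewrite pnatr_eq0.
have [r rP] := poly_roots_seq P0.
have [s sP] : exists s : seq R[i],
    forall c, c \in r -> forall x, root (Q c) x -> x \in s.
  elim: r {rP} => [|c r [s sP]]; first by exists [::].
  have [s' s'P] := poly_roots_seq (Q0 c); exists (s' ++ s) => c' + x rx.
  rewrite inE mem_cat => /orP[/eqP c'c|/sP/(_ _ rx) ->]; last by rewrite orbT.
  by rewrite s'P// -c'c.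
exists s => x x1 xs; split=> // c c1 c0 cx; move/negP: xs; apply.
apply: (sP c).
  apply: rP; rewrite /root PE -c0 /fiber_quadratic; apply/eqP; ring.
have x2 := lt1_neq2 x1.
by rewrite /root QE cx /blaschke divfK// subrr.
Qed.

End Covering.

Section PolydiscMap.
Context {R : realType} {n : nat}.
Implicit Types x c : R[i].
Implicit Types z w : 'rV[R[i]]_n.+1.

Definition blaschke_map : 'rV[R[i]]_n.+1 -> 'rV[R[i]]_n.+1 :=
  shear (fun x => blaschke x - x).

Lemma blaschke_mapE z j :
  blaschke_map z 0 j = if j == 0 then blaschke (z 0 0) else z 0 j.
Proof. by rewrite /blaschke_map shearE addrC subrK. Qed.

Lemma is_derive_blaschkeB_id x : 2 - x != 0 ->
  is_derive x 1 (fun x => blaschke x - x) (fiber_quadratic x x / (2 - x) ^+ 2 - 1).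
Proof.
move=> x2; have db := is_derive_blaschke x2.
exact: (is_deriveB db (is_derive_id x 1)).
Qed.

Lemma blaschke_map_differentiable z : 2 - z 0 0 != 0 -> differentiable blaschke_map z.
Proof. by move=> z2; have [] := diff_shear (is_derive_blaschkeB_id z2). Qed.

Lemma det_jacobian_blaschke_map z : 2 - z 0 0 != 0 ->
  \det ('J blaschke_map z) = fiber_quadratic (z 0 0) (z 0 0) / (2 - z 0 0) ^+ 2.
Proof.
by move=> z2; rewrite (det_jacobian_shear (is_derive_blaschkeB_id z2)) addrC subrK.
Qed.

Lemma polydisc_blaschke_map : set_fun (polydisc R n.+1) (polydisc R n.+1) blaschke_map.
Proof.
by move=> z zd j; rewrite blaschke_mapE; case: ifP => _; [exact/blaschke_lt1|].
Qed.

(** Whether a point lies over a critical value depends on its first coordinate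
    only: the Jacobian determinant is the derivative of [blaschke] there, and
    the other coordinates of a critical point can be chosen freely. *)
Lemma unbranched_partE z : unbranched_part (polydisc R n.+1) blaschke_map z <->
  polydisc R n.+1 z /\ unbranched_disc (z 0 0).
Proof.
split=> [[zd zb]|[zd [_ zb]]]; split=> //.
  split=> // c c1 c0 cz; apply: zb.
  have wd : polydisc R n.+1 (set_first z c).
    by move=> j; rewrite mxE; case: ifP.
  have w0 : set_first z c 0 0 = c by rewrite mxE eqxx.
  exists (set_first z c).
    by split=> //; rewrite det_jacobian_blaschke_map w0 ?lt1_neq2// c0 mul0r.
  apply/rowP => j; rewrite !blaschke_mapE w0 cz; case: eqP => // /eqP j0.
  by rewrite mxE (negPf j0).
move=> [w [wd w0] wz].
apply: (zb (w 0 0)) => //.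
  move/eqP: w0; rewrite det_jacobian_blaschke_map ?lt1_neq2//.
  by rewrite mulf_eq0 invr_eq0 expf_eq0/= (negPf (lt1_neq2 (wd 0))) orbF => /eqP.
by have := congr1 (fun v : 'rV__ => v 0 0) wz; rewrite !blaschke_mapE.
Qed.

Local Notation B := blaschke_map.
Local Notation D := (polydisc R n.+1).

(** The preimage of a compact set [K] is closed in the compact closed polydisc:
    at a limit point [p] the map is still continuous, so its value is in [K],
    and then [p] is not on the boundary because [blaschke] maps the circle to
    itself. *)
Lemma proper_blaschke_map : proper_on D D B.
Proof.
move=> K KD cK.
pose Dbar : set 'rV[R[i]]_n.+1 := [set z | forall j, `|z 0 j| <= 1].
have cDbar : compact Dbar.
  exact: (@rV_compact R[i] n.+1 (fun=> [set z : R[i] | `|z| <= 1])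
    (fun=> closed_disc_compact)).
have clDbar : closed Dbar by apply: compact_closed => //; exact: norm_hausdorff.
have clK : closed K by apply: compact_closed => //; exact: norm_hausdorff.
apply: (subclosed_compact _ cDbar); last first.
  by move=> z [zD _] j; exact/ltW/zD.
move=> p clp.
have pbar : Dbar p.
  apply: clDbar => V /clp[q [[qD _] Vq]]; exists q; split=> // j; exact/ltW/qD.
have BpK : K (B p).
  have cB : {for p, continuous B}.
    exact/differentiable_continuous/blaschke_map_differentiable/le1_neq2.
  by apply: clK => V /cB /clp[q [[_ BqK] Vq]]; exists (B q).
split=> // j; have := KD _ BpK j; rewrite blaschke_mapE.
case: eqP => // -> bp; rewrite lt_neqAle pbar andbT.
by apply: contraTneq bp => /norm_blaschke1 ->; rewrite ltxx.
Qed.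

Lemma proper_holomorphic_blaschke_map : proper_holomorphic D D B.
Proof.
split; [|exact: polydisc_blaschke_map|exact: proper_blaschke_map].
by move=> z zD; exact/blaschke_map_differentiable/lt1_neq2.
Qed.

Lemma blaschke_map_not_biholomorphic : ~ biholomorphic D D B.
Proof.
move=> [_ _ [g [_ _ gK _]]].
have D0 : D 0 by move=> j; rewrite mxE normr0.
pose h : 'rV[R[i]]_n.+1 := set_first 0 2^-1.
have Dh : D h.
  move=> j; rewrite /h !mxE; case: ifP => _; last by rewrite normr0.
  by rewrite ger0_norm ?invr_ge0// invf_lt1// ltr1n.
have Bh : B h = B 0.
  apply/rowP => j; rewrite !blaschke_mapE /h !mxE eqxx; case: (j == 0) => //.
  by rewrite /blaschke mulfV ?pnatr_eq0// subrr expr0n /= mulr0 !mul0r.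
have : h = 0 by rewrite -(gK h) ?inE// Bh gK ?inE.
move=> /rowP/(_ 0)/eqP; rewrite /h !mxE eqxx.
by rewrite invr_eq0 pnatr_eq0.
Qed.

(** On the slice through [z] the first coordinate of [h] is a continuous section
    of the fibres of [blaschke], to which [section_rigid] applies. *)
Lemma Deck_blaschke_map_fixes (h : 'rV[R[i]]_n.+1 -> 'rV[R[i]]_n.+1) z :
  Deck D B h -> unbranched_part D B z -> h z = z.
Proof.
set W := unbranched_part D B => -[[hol hW _] Bh _] Wz.
have [zD Wz0] := (unbranched_partE z).1 Wz.
have Wset x : unbranched_disc x -> W (set_first z x).
  move=> [x1 xb]; apply/unbranched_partE; split.
    by move=> j; rewrite mxE; case: ifP.
  by rewrite mxE eqxx.
pose g x := h (set_first z x) 0 0.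
have [s sP] := @cofinite_unbranched_disc R.
have rigid : forall x, unbranched_disc x -> g x = x.
  apply: (@section_rigid R s) => //.
  - by move=> x [].
  - move=> x Wx.
    exact/slice_continuous/differentiable_continuous/hol/Wset.
  - move=> x Wx; have Ws := Wset _ Wx.
    have x2 := lt1_neq2 Wx.1.
    have gx2 : 2 - g x != 0.
      by apply: lt1_neq2; have [hD _] := hW _ Ws; exact: hD.
    have /rowP/(_ 0) := Bh _ Ws; rewrite !blaschke_mapE mxE /=.
    exact: blaschke_fiber.
  - by move=> x [x1 xb]; apply/eqP => /(xb x x1).
apply/rowP => j; have [->|j0] := eqVneq j 0.
  by have := rigid _ Wz0; rewrite /g set_first_id.
by have /rowP/(_ j) := Bh _ Wz; rewrite !blaschke_mapE (negPf j0).
Qed.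

Lemma Deck_blaschke_map : Deck D B = [set idfun].
Proof.
apply/seteqP; split=> [h dh|_ ->] /=.
  apply/funext => z; have [Wz|Wz] := pselect (unbranched_part D B z).
    exact: Deck_blaschke_map_fixes.
  by case: dh => _ _; exact.
have hid : holomorphic_on (unbranched_part D B) idfun by move=> z _; exact: ex_diff.
by split=> //; split=> //; exists idfun; split.
Qed.

End PolydiscMap.

Theorem proposition3p5 (R : realType) (d : nat) (hd : (1 <= d)%N) :
  exists B : 'rV[R[i]]_d -> 'rV[R[i]]_d,
    [/\ proper_holomorphic (polydisc R d) (polydisc R d) B,
        ~ biholomorphic (polydisc R d) (polydisc R d) B &
        Deck (polydisc R d) B = [set idfun]].
Proof.
case: d hd => [//|n _]; exists (@blaschke_map R n); split.
- exact: proper_holomorphic_blaschke_map.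
- exact: blaschke_map_not_biholomorphic.
- exact: Deck_blaschke_map.
Qed.
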